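(* Up to projective equivalence, there are exactly two sets without tangents of size $10$ in $\mathrm{PG}(2,5)$: (i) the trivial set, namely the set of points on two distinct lines $L_1$ and $L_2$, other than $L_1\cap L_2$; (ii) the set of interior points of an irreducible conic in $\mathrm{PG}(2,5)$. These two sets are not projectively equivalent. *)

(* Defs.v *)
(* PG(2,5) modelled via row spaces in 'F_5^3. *)
From HB Require Import structures.
From mathcomp Require Import all_boot all_order all_algebra all_fingroup.
Set Implicit Arguments. Unset Strict Implicit. Unset Printing Implicit Defensive.
Import GRing.Theory.
Local Open Scope ring_scope.

Notation F := 'F_5.
Notation M3 := 'M[F]_3.

(* A point of PG(2,5) is a 1-dimensional subspace of F^3, represented
   canonically by the square matrix <<A>> (rank 1, equal to its own
   canonical row-space representative). *)
Definition points : {set M3} :=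
  [set A : M3 | (\rank A == 1)%N && (<<A>>%MS == A)].

(* A line is any 3x3 matrix of rank 2 (its row space); incidence of a
   point p and a line L is (p <= L)%MS. *)
Definition is_line (L : M3) : bool := (\rank L == 2)%N.

Definition tangent_free (S : {set M3}) : Prop :=
  forall L : M3, is_line L -> #|[set p in S | (p <= L)%MS]| != 1%N.

(* Projective equivalence under PGL(3,5) (= PGammaL(3,5), 5 prime). *)
Definition proj_image (g : M3) (S : {set M3}) : {set M3} :=
  [set <<p *m g>>%MS | p in S].
Definition proj_equiv (S T : {set M3}) : Prop :=
  exists g : M3, g \in unitmx /\ T = proj_image g S.

Definition trivial_set (T : {set M3}) : Prop :=
  exists L1 L2 : M3, is_line L1 /\ is_line L2 /\ ~~ (L1 == L2)%MS /\
    T = [set p in points | (p <= L1)%MS != (p <= L2)%MS].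

(* Conic defined by a symmetric matrix A: points whose vectors v satisfy
   v A v^T = 0. Irreducible (non-degenerate) iff det A != 0. *)
Definition conic (A : M3) : {set M3} :=
  [set p in points |
    [forall v : 'rV[F]_3, (v <= p)%MS ==> (v *m A *m v^T == 0)]].

Definition interior (A : M3) : {set M3} :=
  [set p in points | (p \notin conic A) &&
    [forall L : M3, (is_line L && (p <= L)%MS) ==>
        (#|[set q in conic A | (q <= L)%MS]| != 1%N)]].

Definition conic_interior_set (T : {set M3}) : Prop :=
  exists A : M3, A^T = A /\ \det A != 0 /\ T = interior A.

(* Main.v *)
Require Import Defs.
From HB Require Import structures.
From mathcomp Require Import all_boot all_order all_algebra all_fingroup.
From mathcomp Require Import ring.
Set Implicit Arguments. Unset Strict Implicit. Unset Printing Implicit Defensive.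
Import GRing.Theory.
Local Open Scope ring_scope.

(** Homogeneous coordinates turn PG(2,5) into a 31 x 31 incidence table. A
    tangent-free set of 10 points contains a triangle, since a line has only 6
    points; if it lay on the sides of the triangle, each of the four other
    lines through a vertex would force its point on the opposite side, giving
    15 points. Hence it contains a frame, and PGL(3,5) moves it to the standard
    frame. A backtracking search, which always branches on a point of a line
    meeting the current partial set exactly once, finds the 31 tangent-free
    10-sets through that frame: 3 pairs of lines and 28 conic interiors. Two
    distinct lines can be moved to any other two by a basis change in the dual
    space, and every nonsingular symmetric form over F_5 is, up to scalar,
    congruent to the identity. A pair of lines has a 5-secant, whereas no line
    meets a conic interior in more than 3 points. *)

(** * Symmetric matrices and completion of bases *)

(** Full row rank turns the middle factor of the rank decomposition into an identity block followed
    by zeros, so [V] is an invertible multiple of the upper rows of [row_ebase V]; the lower rows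
    complete it. *)
Lemma row_free_completion (K : fieldType) m n (V : 'M[K]_(m, m + n)) :
  row_free V -> exists W, col_mx V W \in unitmx.
Proof.
move=> /eqP rV; exists (dsubmx (row_ebase V)).
suff -> : col_mx V (dsubmx (row_ebase V)) =
    block_mx (col_ebase V) 0 0 1%:M *m row_ebase V.
  rewrite unitmx_mul row_ebase_unit andbT unitmxE det_ublock det1 mulr1.
  by rewrite -unitmxE col_ebase_unit.
rewrite -[X in _ *m X]vsubmxK mul_block_col !mul0mx add0r addr0 mul1mx.
congr col_mx; rewrite -[LHS]mulmx_ebase rV -[X in _ *m X = _]vsubmxK.
have -> : pid_mx m = row_mx 1%:M 0 :> 'M[K]_(m, m + n).
  apply/matrixP=> i j; rewrite !mxE ltn_ord andbT.
  case: splitP => k jk; rewrite !mxE jk //.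
  by rewrite ltn_eqF // ltn_addr.
by rewrite -mulmxA mul_row_col mul1mx mul0mx addr0.
Qed.

(** Polarization: if the diagonal entries at [i] and [j] vanish, the form takes the value 2 [A i j]
    at [e i + e j]. *)
Lemma sym_anisotropic (K : fieldType) n (A : 'M[K]_n) :
  2%:R != 0 :> K -> A^T = A -> A != 0 ->
  exists v : 'rV_n, v *m A *m v^T != 0.
Proof.
move=> n2 sA /matrix0Pn[i [j nzA]].
pose e k : 'rV[K]_n := delta_mx 0 k.
have eE k l : e k *m A *m (e l)^T = (A k l)%:M.
  rewrite trmx_delta -rowE -colE; apply/matrixP=> x y.
  by rewrite !mxE (ord1 x) (ord1 y) mulr1n.
have nzM (a : K) : a != 0 -> a%:M != 0 :> 'M_1.
  by apply: contra => /eqP/matrixP/(_ 0 0); rewrite !mxE mulr1n => ->.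
have [Aii|/nzM] := eqVneq (A i i) 0; last by exists (e i); rewrite eE.
have [Ajj|/nzM] := eqVneq (A j j) 0; last by exists (e j); rewrite eE.
exists (e i + e j).
rewrite mulmxDl raddfD /= mulmxDl !mulmxDr !eE Aii Ajj raddf0 add0r addr0.
have -> : A j i = A i j by rewrite -[in LHS]sA mxE.
by rewrite -raddfD /= nzM // -mulr2n -mulr_natr mulf_neq0.
Qed.

(** Gram-Schmidt by induction: a vector of nonzero norm is extended to a basis, its orthogonal
    complement is split off, and the induction hypothesis applies to the complement. *)
Lemma sym_diagonalizable (K : fieldType) n (A : 'M[K]_n) :
  2%:R != 0 :> K -> A^T = A ->
  exists2 g, g \in unitmx & is_diag_mx (g *m A *m g^T).
Proof.
move=> n2; elim: n A => [|n IHn] A sA.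
  exists 1%:M; rewrite ?unitmx1 //.
  by apply/is_diag_mxP=> -[].
have [A0|nzA] := eqVneq A 0.
  exists 1%:M; rewrite ?unitmx1 // A0 mulmx0 mul0mx.
  by apply/is_diag_mxP=> i j _; rewrite mxE.
have [v nzv] := sym_anisotropic n2 sA nzA.
have fv : row_free (v : 'M_(1, 1 + n)).
  have nv : v != 0 by apply: contraNneq nzv => ->; rewrite !mul0mx.
  by rewrite /row_free rank_rV nv.
have [W uH] := row_free_completion fv.
set h : 'M_(1 + n) := col_mx _ _ in uH.
pose B : 'M_(1 + n) := h *m (A : 'M_(1 + n)) *m h^T.
have sB : B^T = B by rewrite /B !trmx_mul trmxK sA mulmxA.
pose a := ulsubmx B; pose b := ursubmx B; pose D := drsubmx B.
have aE : a = v *m (A : 'M_(1 + n)) *m v^T.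
  by rewrite /a /B /ulsubmx /h mul_col_mx mul_col_mx col_mxKu tr_col_mx
             mul_mx_row row_mxKl.
have [c aM] : exists c, a = c%:M by exists (a 0 0); apply: mx11_scalar.
have nzc : c != 0.
  by apply: contraNneq nzv => c0; rewrite -aE aM c0 raddf0.
have bE : dlsubmx B = b^T by rewrite /b trmx_ursub sB.
have BE : B = block_mx c%:M b b^T D by rewrite -aM -bE -[LHS]submxK.
(* Block elimination with pivot [c]: congruence by [k] clears the off-diagonal blocks and leaves the
   Schur complement [D']. *)
pose k : 'M_(1 + n) := block_mx 1%:M 0 (- c^-1 *: b^T) 1%:M.
have uk : k \in unitmx by rewrite unitmxE det_lblock !det1 mulr1 unitr1.
pose D' := D - c^-1 *: (b^T *m b).
have kB : k *m B *m k^T = block_mx c%:M 0 0 D'.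
  rewrite BE /k tr_block_mx !mulmx_block !trmx0 !trmx1 linearZ /= trmxK.
  rewrite !mul1mx !mul0mx !mulmx1 !mulmx0 !addr0.
  rewrite -!scalemxAl -!scalemxAr mul_scalar_mx mul_mx_scalar !scalerA.
  rewrite !mulNr !mulVf // !scaleN1r !addNr mul0mx scaler0 add0r.
  by rewrite /D' scaleNr addrC.
have sD : D^T = D by rewrite /D trmx_drsub sB.
have sD' : D'^T = D'.
  by rewrite /D' linearB linearZ /= trmx_mul trmxK sD.
have [g ug dg] := IHn D' sD'.
pose G : 'M_(1 + n) := block_mx 1%:M 0 0 g.
have uG : G \in unitmx by rewrite unitmxE det_lblock det1 mul1r -unitmxE.
exists (G *m k *m h : 'M_(1 + n)); first by rewrite !unitmx_mul uG uk uH.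
have -> : G *m k *m h *m (A : 'M_(1 + n)) *m (G *m k *m h)^T =
    G *m (k *m B *m k^T) *m G^T.
  by rewrite /B !trmx_mul !mulmxA.
rewrite kB /G tr_block_mx !mulmx_block !trmx0 !trmx1.
rewrite !mul1mx !mul0mx !mulmx1 !mulmx0 !addr0 !add0r mul0mx.
rewrite (@is_diag_block_mx _ 1 n 1 n) // !eqxx /= dg andbT.
exact: scalar_mx_is_diag.
Qed.

Lemma unitmx_nokernel (K : fieldType) n (M : 'M[K]_n) :
  (forall v : 'rV_n, v != 0 -> M *m v^T != 0) -> M \in unitmx.
Proof.
move=> H; rewrite -unitmx_tr -row_free_unit -kermx_eq0.
apply: contraT; rewrite -nz_row_eq0 => /H /eqP[]; apply: trmx_inj.
rewrite trmx_mul trmxK trmx0; apply/eqP; rewrite -sub_kermx.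
exact: nz_row_sub.
Qed.

(** * Projective images *)

Lemma pointsP (p : M3) :
  reflect (exists2 v : 'rV[F]_3, v != 0 & p = <<v>>%MS) (p \in points).
Proof.
rewrite inE; apply: (iffP andP) => [[/eqP rp /eqP gp]|[v nzv ->]].
  have nz : nz_row p != 0 by rewrite nz_row_eq0 -mxrank_eq0 rp.
  exists (nz_row p) => //; rewrite -{1}gp.
  apply/esym/genmxP.
  by rewrite -(mxrank_leqif_eq (nz_row_sub p)) rank_rV nz rp.
by rewrite genmx_id mxrank_gen rank_rV nzv.
Qed.

Lemma gen_points (v : 'rV[F]_3) : v != 0 -> <<v>>%MS \in points.
Proof. by move=> nzv; apply/pointsP; exists v. Qed.

Lemma points_genmx (p : M3) : p \in points -> <<p>>%MS = p.
Proof. by rewrite inE => /andP[_ /eqP]. Qed.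

Lemma genmx_mul_gen (K : fieldType) m n (v : 'M[K]_(m, n)) (g : 'M_n) :
  <<<<v>> *m g>>%MS = <<v *m g>>%MS.
Proof. by apply: eq_genmx; apply: eqmxMr; apply: genmxE. Qed.

Lemma mulmx_unit_eq0 (K : comUnitRingType) m n (v : 'M[K]_(m, n)) (g : 'M_n) :
  g \in unitmx -> (v *m g == 0) = (v == 0).
Proof.
move=> ug; apply/eqP/eqP => [vg|->]; last exact: mul0mx.
by rewrite -[v](mulmxK ug) vg mul0mx.
Qed.

Lemma proj_points (g p : M3) :
  g \in unitmx -> p \in points -> <<p *m g>>%MS \in points.
Proof.
move=> ug /pointsP[v nzv ->]; rewrite genmx_mul_gen gen_points //.
by rewrite mulmx_unit_eq0.
Qed.

Lemma projK (g p : M3) :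
  g \in unitmx -> p \in points -> <<<<p *m g>> *m invmx g>>%MS = p.
Proof. by move=> ug pP; rewrite genmx_mul_gen mulmxK // points_genmx. Qed.

Lemma projVK (g p : M3) :
  g \in unitmx -> p \in points -> <<<<p *m invmx g>> *m g>>%MS = p.
Proof. by move=> ug pP; rewrite genmx_mul_gen mulmxKV // points_genmx. Qed.

Lemma mem_proj_image (g : M3) (S : {set M3}) (p : M3) :
  g \in unitmx -> S \subset points -> p \in points ->
  (p \in proj_image g S) = (<<p *m invmx g>>%MS \in S).
Proof.
move=> ug /subsetP SP pP; apply/imsetP/idP => [[q qS ->]|qS].
  by rewrite projK // SP.
by exists <<p *m invmx g>>%MS; rewrite ?projVK.
Qed.

Lemma proj_image_points (g : M3) (S : {set M3}) :
  g \in unitmx -> S \subset points -> proj_image g S \subset points.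
Proof.
move=> ug /subsetP SP; apply/subsetP=> _ /imsetP[p pS ->].
by rewrite proj_points ?SP.
Qed.

Lemma proj_inj (g : M3) (S : {set M3}) : g \in unitmx -> S \subset points ->
  {in S &, injective (fun p : M3 => <<p *m g>>%MS)}.
Proof.
move=> ug /subsetP SP p q pS qS pq.
by rewrite -(projK ug (SP _ pS)) pq projK ?SP.
Qed.

Lemma card_proj_image (g : M3) (S : {set M3}) :
  g \in unitmx -> S \subset points -> #|proj_image g S| = #|S|.
Proof. by move=> ug SP; apply: card_in_imset; apply: proj_inj. Qed.

Lemma card_line_proj (g : M3) (S : {set M3}) (L : M3) :
  g \in unitmx -> S \subset points ->
  #|[set p in proj_image g S | (p <= L)%MS]| =
  #|[set p in S | (p <= L *m invmx g)%MS]|.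
Proof.
move=> ug SP; rewrite -(@card_proj_image g [set p in S | (p <= L *m invmx g)%MS]) //.
  congr #|pred_of_set _|; apply/setP=> p; rewrite !inE.
  have leE (q : M3) : (<<q *m g>> <= L)%MS = (q <= L *m invmx g)%MS.
    by rewrite genmxE -{1}[L](mulmxKV ug) submxMfree ?row_free_unit.
  apply/andP/imsetP => [[/imsetP[q qS ->]]|[q]].
    by rewrite leE => qL; exists q; rewrite // inE qS.
  rewrite inE => /andP[qS qL] ->; rewrite leE; split=> //.
  by apply/imsetP; exists q.
by apply: subset_trans SP; apply/subsetP=> p; rewrite inE => /andP[].
Qed.

Lemma is_lineM (g L : M3) : g \in unitmx -> is_line (L *m g) = is_line L.
Proof. by move=> ug; rewrite /is_line mxrankMfree // row_free_unit. Qed.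

Lemma tangent_free_proj (g : M3) (S : {set M3}) :
  g \in unitmx -> S \subset points -> tangent_free S ->
  tangent_free (proj_image g S).
Proof.
move=> ug SP tS L lL; rewrite card_line_proj //; apply: tS.
by rewrite is_lineM // unitmx_inv.
Qed.

Lemma proj_image_mul (g h : M3) (S : {set M3}) :
  proj_image h (proj_image g S) = proj_image (g *m h) S.
Proof.
rewrite /proj_image -imset_comp; apply: eq_imset => p /=.
by rewrite genmx_mul_gen mulmxA.
Qed.

Lemma proj_image1 (S : {set M3}) : S \subset points -> proj_image 1%:M S = S.
Proof.
move=> /subsetP SP; rewrite -[RHS]imset_id; apply: eq_in_imset => p pS.
by rewrite mulmx1 points_genmx ?SP.
Qed.

Lemma proj_equiv_sym (S T : {set M3}) :
  S \subset points -> proj_equiv S T -> proj_equiv T S.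
Proof.
move=> SP [g [ug ->]]; exists (invmx g); rewrite unitmx_inv; split=> //.
by rewrite proj_image_mul mulmxV // proj_image1.
Qed.

Lemma proj_equiv_trans (S T U : {set M3}) :
  proj_equiv S T -> proj_equiv T U -> proj_equiv S U.
Proof.
move=> [g [ug ->]] [h [uh ->]]; exists (g *m h).
by rewrite unitmx_mul ug uh proj_image_mul.
Qed.

Lemma conic_sub (A : M3) : conic A \subset points.
Proof. by apply/subsetP=> p; rewrite inE => /andP[]. Qed.

Lemma interior_sub (A : M3) : interior A \subset points.
Proof. by apply/subsetP=> p; rewrite inE => /andP[]. Qed.

(** The form is homogeneous of degree 2, so its vanishing on one spanning vector decides for the
    whole point. *)
Lemma mem_conic (A : M3) (v : 'rV[F]_3) : v != 0 ->
  (<<v>>%MS \in conic A) = (v *m A *m v^T == 0).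
Proof.
move=> nzv; rewrite inE gen_points //=.
apply/forallP/eqP => [/(_ v)|vAv w].
  by rewrite genmxE submx_refl => /eqP.
apply/implyP; rewrite genmxE => /sub_rVP[a ->].
by rewrite linearZ /= -!scalemxAl -scalemxAr vAv !scaler0.
Qed.

(** The scalar [c] is allowed because proportional forms have the same zeros; forms will be
    normalized only up to scalar. *)
Lemma conic_proj (A B g : M3) (c : F) : g \in unitmx -> c != 0 ->
  g *m A *m g^T = c *: B -> conic A = proj_image g (conic B).
Proof.
move=> ug nzc gA; apply/setP=> p.
have [|pP] := boolP (p \in points); last first.
  rewrite (contraNF (subsetP (conic_sub A) p)) //.
  apply/esym/negbTE; apply: contra pP; apply/subsetP.
  exact: proj_image_points (conic_sub B).
move=> pP; rewrite (mem_proj_image ug (conic_sub B) pP).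
have /pointsP[v nzv ->] := pP.
rewrite genmx_mul_gen !mem_conic ?mulmx_unit_eq0 ?unitmx_inv //.
rewrite -[RHS](inj_eq (scalerI nzc)) scaler0.
rewrite scalemxAl scalemxAr -gA !trmx_mul !mulmxA mulmxKV //.
by rewrite -(mulmxA (v *m A)) -trmx_mul mulVmx // trmx1 mulmx1.
Qed.

Lemma mem_interior (A p : M3) : p \in points -> (p \in interior A) =
  (p \notin conic A) && [forall L : M3, (is_line L && (p <= L)%MS) ==>
    (#|[set q in conic A | (q <= L)%MS]| != 1%N)].
Proof. by move=> pP; rewrite [LHS]in_set pP. Qed.

(** Being interior is expressed by incidence with the conic and its tangents alone, so it follows
    the conic under a collineation. *)
Lemma interior_proj (A B g : M3) (c : F) : g \in unitmx -> c != 0 ->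
  g *m A *m g^T = c *: B -> interior A = proj_image g (interior B).
Proof.
move=> ug nzc gA; apply/setP=> p.
have [|pP] := boolP (p \in points); last first.
  rewrite (contraNF (subsetP (interior_sub A) p)) //.
  apply/esym/negbTE; apply: contra pP; apply/subsetP.
  exact: proj_image_points (interior_sub B).
move=> pP; rewrite (mem_proj_image ug (interior_sub B) pP).
have ugV : invmx g \in unitmx by rewrite unitmx_inv.
rewrite (mem_interior _ pP) (mem_interior _ (proj_points ugV pP)).
have -> : (p \in conic A) = (<<p *m invmx g>>%MS \in conic B).
  by rewrite (conic_proj ug nzc gA) (mem_proj_image ug (conic_sub B) pP).
apply/andP/andP => -[nC /forallP H]; (split; first exact: nC);
  apply/forallP=> L; apply/implyP=> /andP[lL pL].
  have := H (L *m g); rewrite (is_lineM _ ug) lL.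
  rewrite (conic_proj ug nzc gA) (card_line_proj _ ug (conic_sub B)).
  rewrite (mulmxK ug) => /implyP; apply; rewrite genmxE in pL.
  by rewrite -(mulmxKV ug p) submxMfree ?row_free_unit.
have := H (L *m invmx g); rewrite (is_lineM _ ugV) lL genmxE.
rewrite submxMfree ?row_free_unit // pL.
by rewrite (conic_proj ug nzc gA) (card_line_proj _ ug (conic_sub B)).
Qed.

(** * Search for tangent-free sets *)

(* A partial set assigns [Some true] to chosen points, [Some false] to excluded
   points and [None] to undecided ones; a line is the mask of its points. *)
Definition chosen (x : option bool) : bool :=
  if x is Some true then true else false.

Definition agree (s : seq (option bool)) (b : bitseq) : bool :=
  all2 (fun o x => if o is Some y then x == y else true) s b.

Definition tangent (s : seq (option bool)) (m : bitseq) : bool :=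
  if filter chosen (mask m s) is [:: _] then true else false.

Fixpoint decide (x : bool) (m : bitseq) (s : seq (option bool)) :=
  match m, s with
  | b :: m', o :: s' =>
      if b && ~~ isSome o then Some x :: s' else o :: decide x m' s'
  | _, _ => s
  end.

(** Here [k] is the required size and [n] bounds the depth. A tangent line needs a second point, so
    the state is dead if [k] points are already chosen or the line is fully decided. Running out of
    depth returns [false], so [true] is a certificate. *)
Fixpoint search (lines goals : seq bitseq) (k n : nat)
    (s : seq (option bool)) : bool :=
  if n is n'.+1 then
    let branch m := search lines goals k n' (decide true m s) &&
                    search lines goals k n' (decide false m s) in
    let full := (size (filter chosen s) == k)%N in
    if filter (tangent s) lines is m :: _ then
      [|| full, all isSome (mask m s) | branch m]
    else if full then map chosen s \in goals else branch (nseq (size s) true)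
  else false.

Lemma agree_decide m s b : agree s b ->
  agree (decide true m s) b || agree (decide false m s) b.
Proof.
elim: m s b => [|x m IH] [|o s] [|y b] //=; first by move=> ->.
case/andP=> oy sb; case: ifP => _ /=.
  by rewrite !sb !andbT; case: (y).
by rewrite !oy /=; apply: IH.
Qed.

Lemma agree_mask m s b : agree s b -> agree (mask m s) (mask m b).
Proof.
elim: m s b => [|x m IH] [|o s] [|y b] //= /andP[oy sb].
by case: x => /=; rewrite ?oy IH.
Qed.

Lemma agree_complete s b : agree s b -> all isSome s -> b = map chosen s.
Proof.
elim: s b => [|o s IH] [|y b] //= /andP[oy sb] /andP[o1 /(IH _ sb) <-].
by case: o oy o1 => // -[] /eqP ->.
Qed.

Lemma agree_count s b : agree s b -> (size (filter chosen s) <= count id b)%N.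
Proof.
elim: s b => [|o s IH] [|y b] //= /andP[oy /IH sb].
by case: o oy => [[] /eqP ->|_] //=; apply: (leq_trans sb); apply: leq_addl.
Qed.

(** The chosen points all belong to [b]; when the sizes match, [b] has no room for an undecided
    point. *)
Lemma agree_full s b :
  agree s b -> size (filter chosen s) = count id b -> b = map chosen s.
Proof.
elim: s b => [|o s IH] [|y b] //= /andP[oy sb].
case: o oy => [[] /eqP ->|_] /=.
- by case=> /(IH _ sb) <-.
- by move/(IH _ sb) => <-.
case: y => /= [sz|/(IH _ sb) <- //].
by have := agree_count sb; rewrite sz ltnn.
Qed.

Lemma count_chosen s : count id (map chosen s) = size (filter chosen s).
Proof. by rewrite count_map size_filter. Qed.

Lemma tangent_count s m :
  tangent s m -> count id (mask m (map chosen s)) = 1%N.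
Proof.
by rewrite -map_mask count_chosen /tangent; case: filter => [|? []].
Qed.

(** By induction on the depth, [b] survives in one of the two branches, while at a dead state [b]
    itself would be tangent to [m]. *)
Lemma search_sound lines goals k n s b :
  all (fun m => count id (mask m b) != 1%N) lines -> count id b = k ->
  agree s b -> search lines goals k n s -> b \in goals.
Proof.
move=> tb kb; elim: n s => //= n IH s sb.
have branchP m : search lines goals k n (decide true m s) &&
    search lines goals k n (decide false m s) -> b \in goals.
  by case/andP=> st sf; case/orP: (agree_decide m sb) => /IH; apply.
case Es: (filter (tangent s) lines) => [|m ms].
  case: eqP => [full|_ /branchP //].
  by rewrite -(agree_full sb) // full kb.
have : m \in filter (tangent s) lines by rewrite Es mem_head.
rewrite mem_filter => /andP[tm /(allP tb)].
move=> tm1 /or3P[/eqP full|allm|/branchP //].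
  (* Full state: [b] consists of the chosen points only, exactly one of which lies on [m]. *)
  have bE : b = map chosen s by apply: agree_full; rewrite // full kb.
  by rewrite bE tangent_count in tm1.
(* Fully decided line: [b] restricted to [m] is the chosen part, a single point. *)
have mb := agree_complete (agree_mask m sb) allm.
by rewrite mb map_mask tangent_count in tm1.
Qed.

(** * Homogeneous coordinates *)

(** Coordinates are natural numbers read modulo 5, so that the finite checks reduce by plain
    computation; [vec] leads back to the field. *)
Definition triple := (nat * nat * nat)%type.

(* The vectors whose first nonzero coordinate is 1; they serve both as points
   and, through the dot product, as lines. *)
Definition reps : seq triple :=
  (0, 0, 1)%N :: [seq (0, 1, c)%N | c <- iota 0 5] ++
  [seq (1, b, c)%N | b <- iota 0 5, c <- iota 0 5].

Arguments reps : simpl never.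

Definition vec (s : triple) : 'rV[F]_3 :=
  \row_j (nth 0%N [:: s.1.1; s.1.2; s.2] j)%:R.

Definition dot (s t : triple) : nat :=
  (s.1.1 * t.1.1 + s.1.2 * t.1.2 + s.2 * t.2)%N.

Definition inc (s t : triple) : bool := (5 %| dot s t)%N.

Definition pt (s : triple) : M3 := <<vec s>>%MS.

(** The row space of this kernel is the orthogonal complement of [vec u], so [u] serves as dual
    coordinates of the line. *)
Definition ln (u : triple) : M3 := kermx (vec u)^T.

Lemma natF5_eq0 n : (n%:R == 0 :> F) = (5 %| n)%N.
Proof. by rewrite -(dvdn_pcharf (pchar_Fp (isT : prime 5))). Qed.

Lemma natF5K (a : F) : (val a)%:R = a.
Proof. exact: natr_Zp. Qed.

Lemma ltF5 (a : F) : (val a < 5)%N.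
Proof. by rewrite (leq_trans (ltn_ord a)). Qed.

Lemma sum3 (V : nmodType) (f : 'I_3 -> V) :
  \sum_i f i = f 0 + f 1 + f (inord 2).
Proof.
rewrite !big_ord_recl big_ord0 addr0 addrA.
by congr (_ + f _ + f _); apply/val_inj; rewrite //= inordK.
Qed.

Lemma rowP3 (T : Type) (v w : 'rV[T]_3) :
  v 0 0 = w 0 0 -> v 0 1 = w 0 1 -> v 0 (inord 2) = w 0 (inord 2) -> v = w.
Proof.
move=> e0 e1 e2; apply/rowP=> -[[|[|[|//]]] i].
- by rewrite (_ : Ordinal i = 0) //; apply: val_inj.
- by rewrite (_ : Ordinal i = 1) //; apply: val_inj.
by rewrite (_ : Ordinal i = inord 2) //; apply: val_inj; rewrite /= inordK.
Qed.

Lemma vec0E s : vec s 0 0 = s.1.1%:R.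
Proof. by rewrite mxE. Qed.

Lemma vec1E s : vec s 0 1 = s.1.2%:R.
Proof. by rewrite mxE. Qed.

Lemma vec2E s : vec s 0 (inord 2) = s.2%:R.
Proof. by rewrite mxE inordK. Qed.

Definition vecE := (vec0E, vec1E, vec2E).

Lemma vec_dot s t : vec s *m (vec t)^T = (dot s t)%:R%:M.
Proof.
apply/matrixP=> i j; rewrite !ord1 mxE sum3 ![_^T _ _]mxE !vecE mxE eqxx mulr1n.
by rewrite !natrD !natrM.
Qed.

Lemma scalar_mx11_eq0 (K : nzRingType) (a : K) : (a%:M == 0 :> 'M_1) = (a == 0).
Proof.
apply/eqP/eqP => [/matrixP/(_ 0 0)|->]; last by rewrite raddf0.
by rewrite !mxE mulr1n.
Qed.

Lemma vec_dot_eq0 s t : (vec s *m (vec t)^T == 0) = inc s t.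
Proof. by rewrite vec_dot scalar_mx11_eq0 natF5_eq0. Qed.

Lemma mem_reps s : (s \in reps) =
  [|| s == (0, 0, 1)%N, (s.1 == (0, 1)%N) && (s.2 < 5)%N |
      [&& s.1.1 == 1%N, (s.1.2 < 5)%N & (s.2 < 5)%N]].
Proof.
have iota5 x : (x \in iota 0 5) = (x < 5)%N by rewrite mem_iota.
case: s => -[a b] c; rewrite inE mem_cat; congr [|| _, _ | _].
  apply/mapP/andP => [[x]|[/eqP[-> ->] c5]].
    by rewrite iota5 => ? [-> -> ->].
  by exists c; rewrite // iota5.
apply/allpairsP/and3P => [[[x y] []]|[/eqP /= -> b5 c5]].
  by rewrite !iota5 => ? ? [-> -> ->].
exists (b, c); split; last by [].
  exact: etrans (iota5 b) b5.
exact: etrans (iota5 c) c5.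
Qed.

Lemma vec_neq0 s : s \in reps -> vec s != 0.
Proof.
move=> sr; apply/eqP=> /rowP v0.
have := v0 0; have := v0 1; have := v0 (inord 2).
rewrite !vecE ![(0 : 'rV_3) _ _]mxE => /eqP; rewrite natF5_eq0 => s2 /eqP.
rewrite natF5_eq0 => s1 /eqP; rewrite natF5_eq0 => s0.
move: sr s0 s1 s2; rewrite mem_reps; case: s {v0} => -[a b] c /=.
case/or3P=> [/eqP[-> -> ->]|/andP[/eqP[-> ->]]|/andP[/eqP->]] //.
Qed.

(** Dividing by the first nonzero coordinate gives the representative; that coordinate is the scalar
    [c]. *)
Lemma vec_surj (v : 'rV[F]_3) : v != 0 ->
  exists s c, [/\ s \in reps, c != 0 & v = c *: vec s].
Proof.
move=> nzv.
have [v0|v0] := eqVneq (v 0 0) 0; last first.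
  exists (1%N, val (v 0 1 / v 0 0), val (v 0 (inord 2) / v 0 0)), (v 0 0).
  split=> //.
    by rewrite mem_reps; apply/or3P/Or33/and3P; split=> //; exact: ltF5.
  apply: rowP3; rewrite [RHS]mxE vecE; first by rewrite mulr1.
    by rewrite natF5K mulrC divfK.
  by rewrite natF5K mulrC divfK.
have [v1|v1] := eqVneq (v 0 1) 0; last first.
  exists (0%N, 1%N, val (v 0 (inord 2) / v 0 1)), (v 0 1).
  split=> //.
    by rewrite mem_reps; apply/or3P/Or32/andP; split=> //; exact: ltF5.
  apply: rowP3; rewrite [RHS]mxE vecE; first by rewrite mulr0 v0.
    by rewrite mulr1.
  by rewrite natF5K mulrC divfK.
exists (0, 0, 1)%N, (v 0 (inord 2)); split.
- by rewrite mem_reps eqxx.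
- apply: contra nzv => /eqP v2; apply/eqP/rowP3; by rewrite ?v0 ?v1 ?v2 mxE.
by apply: rowP3; rewrite [RHS]mxE vecE /= ?mulr1 ?mulr0 ?v0 ?v1.
Qed.

Lemma pt_scale (c : F) (v : 'rV[F]_3) s :
  c != 0 -> v = c *: vec s -> <<v>>%MS = pt s.
Proof. by move=> nzc ->; apply: eq_genmx; apply: eqmx_scale. Qed.

Lemma points_reps (p : M3) : p \in points -> exists2 s, s \in reps & p = pt s.
Proof.
case/pointsP=> v /vec_surj[s [c [sr nzc vE]]] ->.
by exists s; rewrite // (pt_scale nzc vE).
Qed.

Lemma pt_points s : s \in reps -> pt s \in points.
Proof. by move=> sr; rewrite gen_points ?vec_neq0. Qed.

Lemma pt_ln s u : (pt s <= ln u)%MS = inc s u.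
Proof. by rewrite genmxE sub_kermx vec_dot_eq0. Qed.

Lemma uniq_reps : uniq reps.
Proof. by lazy. Qed.

(** A line separates any two distinct points; this yields injectivity of [pt] from incidence alone
    and, dually, tells distinct lines apart. *)
Lemma reps_inj_inc : all (fun s => all (fun t =>
  (s == t) || has (fun u => inc s u != inc t u) reps) reps) reps.
Proof. by lazy. Qed.

Lemma pt_inj : {in reps &, injective pt}.
Proof.
move=> s t sr tr st; have /allP/(_ s sr)/allP/(_ t tr) := reps_inj_inc.
case/orP=> [/eqP //|/hasP[u _]].
by rewrite -!pt_ln st eqxx.
Qed.

Lemma is_line_ln u : u \in reps -> is_line (ln u).
Proof.
by move=> /vec_neq0 nzu; rewrite /is_line /ln mxrank_ker mxrank_tr rank_rV nzu.
Qed.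

(** A nonzero vector annihilating [L] gives [u]; then [L] lies in [ln u], and both have rank 2. *)
Lemma is_line_reps (L : M3) : is_line L ->
  exists2 u, u \in reps & forall p : M3, (p <= L)%MS = (p <= ln u)%MS.
Proof.
move=> /eqP rL.
have nzK : nz_row (kermx L^T) != 0.
  by rewrite nz_row_eq0 -mxrank_eq0 mxrank_ker mxrank_tr rL.
have [u [c [ur nzc vE]]] := vec_surj nzK; exists u => // p.
have LK : (L <= ln u)%MS.
  rewrite sub_kermx -(inj_eq (@trmx_inj _ _ _)) trmx_mul trmxK trmx0.
  have : nz_row (kermx L^T) *m L^T == 0 by rewrite -sub_kermx nz_row_sub.
  by rewrite vE -scalemxAl scalemx_eq0 (negbTE nzc).
suff /eqmxP LE : (L == ln u)%MS by rewrite LE.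
by rewrite -(mxrank_leqif_eq LK) rL eq_sym; apply: is_line_ln.
Qed.

Lemma card_reps (S : {set M3}) (Q : pred M3) : S \subset points ->
  #|[set p in S | Q p]| = count (fun t => (pt t \in S) && Q (pt t)) reps.
Proof.
move=> /subsetP SP; rewrite -size_filter -(size_map pt).
set r := map _ _; have ur : uniq r.
  rewrite map_inj_in_uniq ?filter_uniq ?uniq_reps // => s t.
  by rewrite !mem_filter => /andP[_ sr] /andP[_ tr]; apply: pt_inj.
rewrite -(card_uniqP ur); apply: eq_card => p; rewrite inE.
apply/andP/mapP => [[pS Qp]|[s]]; last first.
  by rewrite mem_filter => /andP[/andP[pS Qp] _] ->.
have [s sr pE] := points_reps (SP _ pS).
by exists s; rewrite // mem_filter -pE pS Qp.
Qed.

(** * Point sets and lines as bit sequences *)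

Definition bits (S : {set M3}) : bitseq := [seq pt t \in S | t <- reps].

Definition line_bits (u : triple) : bitseq := [seq inc t u | t <- reps].

Definition all_lines : seq bitseq := map line_bits reps.

Definition tangent_free_bits (b : bitseq) : bool :=
  all (fun m => count id (mask m b) != 1%N) all_lines.

Lemma card_bits (S : {set M3}) : S \subset points -> #|S| = count id (bits S).
Proof.
move=> SP; rewrite /bits count_map.
have <- : [set p in S | xpredT p] = S by apply/setP=> p; rewrite inE andbT.
rewrite card_reps //; apply: eq_count => t /=.
by rewrite !inE !andbT.
Qed.

Lemma card_line_bits (S : {set M3}) (L : M3) u :
  (forall p : M3, (p <= L)%MS = (p <= ln u)%MS) -> S \subset points ->
  #|[set p in S | (p <= L)%MS]| = count id (mask (line_bits u) (bits S)).
Proof.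
move=> Lu SP; rewrite (card_reps (fun p => (p <= L)%MS)) //.
rewrite /line_bits /bits -map_mask -filter_mask count_map count_filter.
by apply: eq_count => t /=; rewrite Lu pt_ln.
Qed.

Lemma tangent_free_bitsP (S : {set M3}) : S \subset points ->
  reflect (tangent_free S) (tangent_free_bits (bits S)).
Proof.
move=> SP; apply: (iffP allP) => [tS L /is_line_reps[u ur Lu]|tS _ /mapP[u ur ->]].
  by rewrite (card_line_bits Lu) // tS // map_f.
by rewrite -(@card_line_bits S (ln u)) //; apply/tS/is_line_ln.
Qed.

Lemma eq_bits (S T : {set M3}) :
  S \subset points -> T \subset points -> bits S = bits T -> S = T.
Proof.
move=> /subsetP SP /subsetP TP /eq_in_map ST.
apply/setP=> p; have [/points_reps[s sr ->]|pP] := boolP (p \in points).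
  exact: ST.
by rewrite (contraNF (SP p)) // (contraNF (TP p)).
Qed.

Lemma unitmx_reps (M : M3) :
  (forall u, u \in reps -> M *m (vec u)^T != 0) -> M \in unitmx.
Proof.
move=> H; apply: unitmx_nokernel => v /vec_surj[u [c [ur nzc ->]]].
by rewrite linearZ /= -scalemxAr scalemx_eq0 (negbTE nzc) H.
Qed.

Definition rows (r1 r2 r3 : triple) : M3 :=
  \matrix_(i, j) vec (nth r1 [:: r1; r2; r3] i) 0 j.

Lemma row_rows r1 r2 r3 (i : 'I_3) :
  row i (rows r1 r2 r3) = vec (nth r1 [:: r1; r2; r3] i).
Proof. by apply/rowP=> j; rewrite !mxE. Qed.

(** A kernel vector of the matrix would be a line through all three points. *)
Lemma rows_unit r1 r2 r3 :
  (forall u, u \in reps -> ~~ [&& inc r1 u, inc r2 u & inc r3 u]) ->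
  rows r1 r2 r3 \in unitmx.
Proof.
move=> H; apply: unitmx_reps => u ur; apply: contra (H u ur) => /eqP Mu.
have iu (i : 'I_3) : inc (nth r1 [:: r1; r2; r3] i) u.
  by rewrite -vec_dot_eq0 -row_rows -row_mul Mu row0.
by rewrite (iu 0) (iu 1) /=; have := iu (inord 2); rewrite inordK.
Qed.

Definition e1 : triple := (1, 0, 0)%N.
Definition e2 : triple := (0, 1, 0)%N.
Definition e3 : triple := (0, 0, 1)%N.
Definition e123 : triple := (1, 1, 1)%N.

Lemma vec_mul_rows s r1 r2 r3 : vec s *m rows r1 r2 r3 =
  s.1.1%:R *: vec r1 + s.1.2%:R *: vec r2 + s.2%:R *: vec r3.
Proof.
by apply/rowP=> j; rewrite mxE sum3 !mxE /= inordK.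
Qed.

(** * Pairs of lines and conics in coordinates *)

Lemma inc_sym s t : inc s t = inc t s.
Proof.
rewrite /inc /dot; congr (_ %| _)%N.
by rewrite !(mulnC t.1.1) !(mulnC t.1.2) (mulnC t.2).
Qed.

Lemma reps_line_through : all (fun s => all (fun t =>
  (s == t) || (count (fun x => inc s x && inc t x) reps == 1%N)) reps) reps.
Proof. by lazy. Qed.

(** Here [x] is the unique line through the two points; a third point off it makes a triangle, hence
    a basis. *)
Lemma line_through s t : s \in reps -> t \in reps -> s != t ->
  exists2 x, x \in reps & forall r, ~~ inc r x -> rows s t r \in unitmx.
Proof.
move=> sr tr /negbTE st; have /allP/(_ s sr)/allP/(_ t tr) := reps_line_through.
rewrite st orFb -size_filter; case E: (filter _ _) => [|x [|? ?]] // _.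
have xr : x \in reps.
  by have := mem_head x [::]; rewrite -E mem_filter => /andP[].
exists x => // r rx; apply: rows_unit => u ur; apply: contra rx.
case/and3P=> su tu; have : u \in [:: x] by rewrite -E mem_filter su tu.
by rewrite inE => /eqP ->.
Qed.

Lemma reps_line_size : all (fun u => count (inc^~ u) reps == 6%N) reps.
Proof. by lazy. Qed.

Lemma card_line u (S : {set M3}) : u \in reps -> S \subset points ->
  (#|[set p in S | (p <= ln u)%MS]| <= 6)%N.
Proof.
move=> ur SP; rewrite (card_reps (fun p => (p <= ln u)%MS)) //.
rewrite -(eqP (allP reps_line_size u ur)).
by apply: sub_count => s /andP[_]; rewrite pt_ln.
Qed.

Definition triv (u w : triple) : {set M3} :=
  [set p in points | (p <= ln u)%MS != (p <= ln w)%MS].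

Definition triv_bits (u w : triple) : bitseq :=
  [seq inc t u != inc t w | t <- reps].

Lemma triv_sub u w : triv u w \subset points.
Proof. by apply/subsetP=> p; rewrite inE => /andP[]. Qed.

Lemma mem_triv u w p : p \in points ->
  (p \in triv u w) = ((p <= ln u)%MS != (p <= ln w)%MS).
Proof. by move=> pP; rewrite in_set pP. Qed.

Lemma bits_triv u w : bits (triv u w) = triv_bits u w.
Proof.
by apply/eq_in_map => t tr; rewrite mem_triv ?pt_points // !pt_ln.
Qed.

Lemma trivial_set_triv u w : u \in reps -> w \in reps -> u != w ->
  trivial_set (triv u w).
Proof.
move=> ur wr /negbTE uw; exists (ln u), (ln w).
do 2![split; first exact: is_line_ln]; split=> //.
have /allP/(_ u ur)/allP/(_ w wr) := reps_inj_inc; rewrite uw orFb.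
case/hasP=> s sr; rewrite !(inc_sym _ s) -!pt_ln.
by apply: contra => /eqmxP ->.
Qed.

Lemma trivial_setP T : trivial_set T ->
  exists u w, [/\ u \in reps, w \in reps, u != w & T = triv u w].
Proof.
case=> L1 [L2 [/is_line_reps[u ur Lu] [/is_line_reps[w wr Lw] [L12 ->]]]].
exists u, w; split=> //; last by apply/setP=> p; rewrite !in_set Lu Lw.
apply: contraNneq L12 => uw; rewrite Lw -uw -Lu submx_refl.
by rewrite Lu uw -Lw submx_refl.
Qed.

Lemma gen_ln (v : 'rV[F]_3) u : (<<v>> <= ln u)%MS = (v *m (vec u)^T == 0).
Proof. by rewrite genmxE sub_kermx. Qed.

(** Lines transform by the inverse transpose: if [h] has rows [u], [w] and a third independent
    vector, the collineation [invmx h^T] carries the lines [e1], [e2] to [u], [w]. *)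
Lemma triv_std u w : u \in reps -> w \in reps -> u != w ->
  proj_equiv (triv e1 e2) (triv u w).
Proof.
move=> ur wr uw; have [x xr xU] := line_through ur wr uw.
(* Read dually, [x] is the common point of [u] and [w], and [z] is a line missing it; one exists
   since only 6 of the 31 lines pass through [x]. *)
have /hasP[z zr /xU uh] : has (fun z => ~~ inc z x) reps.
  rewrite has_predC; apply/negP=> /all_filterP E.
  by have := allP reps_line_size x xr; rewrite -size_filter E.
set h := rows u w z in uh; have uhT : h^T \in unitmx by rewrite unitmx_tr.
have ugV : invmx h^T \in unitmx by rewrite unitmx_inv.
exists (invmx h^T); split=> //.
apply: eq_bits; rewrite ?triv_sub ?proj_image_points ?triv_sub //.
apply/eq_in_map => s sr; have sP := pt_points sr.
rewrite (mem_proj_image ugV (triv_sub _ _) sP) invmxK genmx_mul_gen.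
have vP : vec s *m h^T != 0 by rewrite mulmx_unit_eq0 ?vec_neq0.
rewrite (mem_triv _ _ sP) (mem_triv _ _ (gen_points vP)) !gen_ln.
have vh i t : vec i *m h = vec t -> vec s *m h^T *m (vec i)^T = vec s *m (vec t)^T.
  by move=> <-; rewrite trmx_mul mulmxA.
by rewrite (vh e1 u) ?(vh e2 w) // vec_mul_rows /= !scale0r !scale1r ?addr0 ?add0r.
Qed.

(** * Quadratic forms and interior points in coordinates *)

Definition qform := (triple * triple * triple)%type.

Definition form_mx (A : qform) : M3 := rows A.1.1 A.1.2 A.2.

Definition form_apply (A : qform) (s : triple) : triple :=
  (dot A.1.1 s, dot A.1.2 s, dot A.2 s).

Definition on_conic (A : qform) (s : triple) : bool := inc s (form_apply A s).

Definition nonsingular (A : qform) : bool :=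
  all (fun u => ~~ [&& inc A.1.1 u, inc A.1.2 u & inc A.2 u]) reps.

Definition interior_bits (A : qform) : bitseq :=
  let c := filter (on_conic A) reps in
  let tangents := filter (fun u => count (inc^~ u) c == 1%N) reps in
  [seq ~~ on_conic A s && ~~ has (inc s) tangents | s <- reps].

Lemma form_mx_vec A s : form_mx A *m (vec s)^T = (vec (form_apply A s))^T.
Proof.
apply/colP=> i; rewrite mxE [RHS]mxE sum3 !mxE /= inordK //.
by case: i => -[|[|[|//]]] i /=; rewrite !natrD !natrM.
Qed.

Lemma conic_form A s : s \in reps -> (pt s \in conic (form_mx A)) = on_conic A s.
Proof.
by move=> sr; rewrite mem_conic ?vec_neq0 // -mulmxA form_mx_vec vec_dot_eq0.
Qed.

Lemma form_det A : nonsingular A -> \det (form_mx A) != 0.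
Proof.
by move=> /allP nA; rewrite -unitfE -unitmxE; apply: rows_unit => u /nA.
Qed.

Lemma bits_interior A : bits (interior (form_mx A)) = interior_bits A.
Proof.
apply/eq_in_map => s sr; rewrite mem_interior ?pt_points // conic_form //.
have cE (L : M3) u : (forall p : M3, (p <= L)%MS = (p <= ln u)%MS) ->
    #|[set q in conic (form_mx A) | (q <= L)%MS]| =
    count (inc^~ u) (filter (on_conic A) reps).
  move=> Lu; rewrite (card_reps (fun q => (q <= L)%MS)) ?conic_sub //.
  rewrite count_filter; apply: eq_in_count => t tr /=.
  by rewrite conic_form // Lu pt_ln andbC.
congr (_ && _); apply/forallP/hasPn => [H u|H L].
  rewrite mem_filter => /andP[tu ur]; have := H (ln u).
  by rewrite is_line_ln // pt_ln (cE _ u) // tu implybF.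
apply/implyP=> /andP[/is_line_reps[u ur Lu]]; rewrite Lu pt_ln => su.
rewrite (cE _ u) //; apply: contraL su => tu; apply: H.
by rewrite mem_filter tu.
Qed.

(** * Normal form of nonsingular diagonal forms *)

Definition wdot (d s t : triple) : nat :=
  dot (s.1.1 * d.1.1, s.1.2 * d.1.2, s.2 * d.2)%N t.

Definition ortho_cond (d r s : triple) (n : nat) : bool :=
  (wdot d r s == n %[mod 5])%N.

Definition all_vecs : seq triple :=
  [seq (x, c) | x <- [seq (a, b) | a <- iota 0 5, b <- iota 0 5], c <- iota 0 5].

(* Comparing discriminants shows that, up to squares, the product of the diagonal
   entries is the only possible common norm. *)
Definition orthogonal_basis (d : triple) : bool :=
  let n := (d.1.1 * d.1.2 * d.2)%N in
  has (fun r1 => ortho_cond d r1 r1 n &&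
  has (fun r2 => [&& ortho_cond d r1 r2 0, ortho_cond d r2 r2 n &
  has (fun r3 => [&& ortho_cond d r1 r3 0, ortho_cond d r2 r3 0 &
                     ortho_cond d r3 r3 n]) all_vecs]) all_vecs) all_vecs.

(* Computed with [lazy]: a call-by-value strategy would evaluate both operands of
   every [&&] and [||] and lose all early exits. *)
Lemma orthogonal_basis_all :
  all (fun d => (5 %| d.1.1 * d.1.2 * d.2)%N || orthogonal_basis d) all_vecs.
Proof. by lazy. Qed.

Lemma eq_modF5 m n : (m == n %[mod 5])%N -> m%:R = n%:R :> F.
Proof.
have p5 : prime 5 by [].
by move=> /eqP mn; rewrite -(Fp_nat_mod p5 m) mn Fp_nat_mod.
Qed.

Lemma mem_all_vecs a b c : (a < 5)%N -> (b < 5)%N -> (c < 5)%N ->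
  (a, b, c) \in all_vecs.
Proof.
move=> a5 b5 c5.
by do ![apply: allpairs_f]; rewrite mem_iota.
Qed.

(** The rows of [g] form an orthogonal basis of common norm [c]. The scalar cannot be dropped, since
    congruence preserves the determinant modulo squares. *)
Lemma diag_std (d : 'rV[F]_3) : (forall i, d 0 i != 0) ->
  exists (g : M3) c, c != 0 /\ g *m diag_mx d *m g^T = c *: 1%:M.
Proof.
move=> nzd; pose t : triple := (val (d 0 0), val (d 0 1), val (d 0 (inord 2))).
have dE : d = vec t by apply: rowP3; rewrite vecE natF5K.
pose n := (t.1.1 * t.1.2 * t.2)%N.
have nzn : n%:R != 0 :> F.
  by rewrite !natrM !natF5K !mulf_neq0.
have tv : t \in all_vecs by apply: mem_all_vecs; apply: ltF5.
have := allP orthogonal_basis_all t tv.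
rewrite -natF5_eq0 -/n (negbTE nzn) orFb.
case/hasP=> r1 _ /andP[n11 /hasP[r2 _ /and3P[n12 n22]]].
case/hasP=> r3 _ /and3P[n13 n23 n33].
exists (rows r1 r2 r3), n%:R; split=> //.
have wE (r s : triple) m : ortho_cond t r s m ->
    \sum_j vec r 0 j * d 0 j * vec s 0 j = m%:R.
  by move=> /eq_modF5 <-; rewrite dE sum3 !vecE !natrD !natrM.
have wC (r s : triple) : \sum_j vec r 0 j * d 0 j * vec s 0 j =
    \sum_j vec s 0 j * d 0 j * vec r 0 j.
  by apply: eq_bigr => j _; ring.
apply/matrixP=> i j; rewrite mul_mx_diag mxE [RHS]mxE [1%:M _ _]mxE.
under eq_bigr do rewrite [X in X * _]mxE [_^T _ _]mxE
  [rows _ _ _ i _]mxE [rows _ _ _ j _]mxE.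
case: i => -[|[|[|//]]] i; case: j => -[|[|[|//]]] j /=;
  rewrite ?mulr1 ?mulr0 ?(wE _ _ _ n11) ?(wE _ _ _ n22) ?(wE _ _ _ n33);
  rewrite ?(wC r2 r1) ?(wC r3 r1) ?(wC r3 r2);
  by rewrite ?(wE _ _ _ n12) ?(wE _ _ _ n13) ?(wE _ _ _ n23).
Qed.

Lemma conic_interior_std T : conic_interior_set T ->
  proj_equiv (interior 1%:M) T.
Proof.
case=> A [sA [dA ->]].
have n2 : 2%:R != 0 :> F by rewrite natF5_eq0.
have [g0 ug0 /is_diag_mxP dg] := sym_diagonalizable n2 sA.
pose d : 'rV[F]_3 := \row_i (g0 *m A *m g0^T) i i.
have gE : g0 *m A *m g0^T = diag_mx d.
  apply/matrixP=> i j; rewrite [RHS]mxE [d _ _]mxE.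
  by case: eqVneq => [->|ij]; rewrite ?mulr1n // mulr0n dg.
have nzd i : d 0 i != 0.
  have : \det (diag_mx d) != 0.
    by rewrite -gE !det_mulmx det_tr !mulf_neq0 // -unitfE -unitmxE.
  by rewrite det_diag => /prodf_neq0 /(_ i isT).
have [g [c [nzc gd]]] := diag_std nzd.
(* Invertibility of [g] is read off the determinant of [c *: 1%:M]. *)
have ug : g \in unitmx.
  have : \det (g *m diag_mx d *m g^T) != 0.
    by rewrite gd scalemx1 det_scalar expf_neq0.
  rewrite unitmxE unitfE; apply: contraNneq => g0E.
  by rewrite !det_mulmx g0E !mul0r.
have ugg : g *m g0 \in unitmx by rewrite unitmx_mul ug.
exists (g *m g0); split=> //; apply: (interior_proj (c := c)) => //.
by rewrite trmx_mul -gd -gE !mulmxA.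
Qed.

(** * Points off the coordinate triangle *)

Definition start (inn out : seq triple) : seq (option bool) :=
  [seq if s \in inn then Some true else if s \in out then Some false else None
  | s <- reps].

Lemma agree_start inn out (S : {set M3}) :
  {in inn, forall s, pt s \in S} -> {in out, forall s, pt s \notin S} ->
  agree (start inn out) (bits S).
Proof.
move=> innP outP; rewrite /start /bits; elim: reps => //= s r IH.
apply/andP; split; last exact: IH.
by case: ifP => [/innP ->|_] //; case: ifP => [/outP/negbTE ->|_].
Qed.

(** Coordinates of representatives are below 5, so the product is positive exactly when none
    vanishes in the field: the point avoids the sides of the triangle. *)
Definition off_triangle : seq triple :=
  [seq s <- reps | (0 < s.1.1 * s.1.2 * s.2)%N].

(** With an empty goal list, success means that no admissible set exists. The depth 31 is the number
    of points, since each branching with a point left to decide settles one. *)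
Lemma search_triangle :
  search all_lines [::] 10 31 (start [:: e1; e2; e3] off_triangle).
Proof. by lazy. Qed.

Lemma triangle_off (S : {set M3}) :
  S \subset points -> #|S| = 10%N -> tangent_free S ->
  pt e1 \in S -> pt e2 \in S -> pt e3 \in S ->
  exists2 r, r \in off_triangle & pt r \in S.
Proof.
move=> SP S10 /(tangent_free_bitsP SP) tS S1 S2 S3.
apply/hasP; apply: contraT => /hasPn offS.
have := search_sound tS _ _ search_triangle; rewrite in_nil; apply.
  by rewrite -card_bits.
by apply: agree_start => // s; rewrite !inE => /or3P[]/eqP ->.
Qed.

(* The form a x^2 + b y^2 + c z^2 + 2 (d x y + e x z + f y z). *)
Definition sym_form (a b c d e f : nat) : qform :=
  ((a, d, e), (d, b, f), (e, f, c)).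

(** * Classification *)

(* The pairs of opposite sides of the frame [e1; e2; e3; e123]. *)
Definition frame_lines : seq (triple * triple) :=
  [:: ((0, 0, 1), (1, 4, 0)); ((0, 1, 0), (1, 0, 4)); ((1, 0, 0), (0, 1, 4))]%N.

(* Representatives, up to scalar, of the conics having the frame among their
   interior points. *)
Definition frame_conics : seq qform :=
  [:: sym_form 1 1 1 0 0 3; sym_form 1 1 1 0 2 2; sym_form 1 1 1 0 3 0;
      sym_form 1 1 1 2 0 2; sym_form 1 1 1 2 2 0; sym_form 1 1 1 3 0 0;
      sym_form 1 1 1 3 3 3; sym_form 1 1 4 0 0 4; sym_form 1 1 4 0 1 4;
      sym_form 1 1 4 0 4 0; sym_form 1 1 4 0 4 1; sym_form 1 1 4 3 0 1;
      sym_form 1 1 4 3 1 0; sym_form 1 1 4 3 1 1; sym_form 1 4 1 0 0 4;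
      sym_form 1 4 1 0 3 1; sym_form 1 4 1 1 0 4; sym_form 1 4 1 1 3 0;
      sym_form 1 4 1 1 3 1; sym_form 1 4 1 4 0 0; sym_form 1 4 1 4 0 1;
      sym_form 1 4 4 0 1 0; sym_form 1 4 4 0 4 2; sym_form 1 4 4 1 0 0;
      sym_form 1 4 4 1 4 0; sym_form 1 4 4 4 0 2; sym_form 1 4 4 4 1 0;
      sym_form 1 4 4 4 4 2].

Definition frame_goals : seq bitseq :=
  [seq triv_bits l.1 l.2 | l <- frame_lines] ++ map interior_bits frame_conics.

Lemma search_frame :
  search all_lines frame_goals 10 31 (start [:: e1; e2; e3; e123] [::]).
Proof. by lazy. Qed.

Definition transpose (A : qform) : qform :=
  ((A.1.1.1.1, A.1.2.1.1, A.2.1.1), (A.1.1.1.2, A.1.2.1.2, A.2.1.2),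
   (A.1.1.2, A.1.2.2, A.2.2)).

Lemma form_mxT A : (form_mx A)^T = form_mx (transpose A).
Proof.
by apply/matrixP=> -[[|[|[|//]]] i] [[|[|[|//]]] j]; rewrite !mxE.
Qed.

Lemma conic_interior_form A : transpose A = A -> nonsingular A ->
  conic_interior_set (interior (form_mx A)).
Proof.
move=> tA nA; exists (form_mx A).
by split; [rewrite form_mxT tA | split; [apply: form_det|]].
Qed.

Lemma frame_conics_ok :
  all (fun A => (transpose A == A) && nonsingular A) frame_conics.
Proof. by lazy. Qed.

Lemma frame_lines_ok :
  all (fun l => [&& l.1 \in reps, l.2 \in reps & l.1 != l.2]) frame_lines.
Proof. by lazy. Qed.

Lemma frame_classification (S : {set M3}) :
  S \subset points -> #|S| = 10%N -> tangent_free S ->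
  {in [:: e1; e2; e3; e123], forall s, pt s \in S} ->
  trivial_set S \/ conic_interior_set S.
Proof.
move=> SP S10 /(tangent_free_bitsP SP) tS frS.
have : bits S \in frame_goals.
  apply: (search_sound tS _ _ search_frame); first by rewrite -card_bits.
  exact: agree_start.
rewrite mem_cat => /orP[/mapP[l lf]|/mapP[A Af]].
  have /and3P[l1 l2 l12] := allP frame_lines_ok l lf.
  rewrite -bits_triv => /eq_bits -> //; last exact: triv_sub.
  by left; apply: trivial_set_triv.
have /andP[/eqP tA nA] := allP frame_conics_ok A Af.
rewrite -bits_interior => /eq_bits -> //; last exact: interior_sub.
by right; apply: conic_interior_form.
Qed.

(** To move points to the standard frame, it suffices that [M] sends the frame vectors to multiples
    of theirs; the inverse of [M] is then applied. *)
Lemma pt_proj (M : M3) (c : F) s t (S : {set M3}) :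
  M \in unitmx -> c != 0 -> vec s *m M = c *: vec t -> pt t \in S ->
  pt s \in proj_image (invmx M) S.
Proof.
move=> uM nzc sM tS; apply/imsetP; exists (pt t) => //.
rewrite genmx_mul_gen; apply/esym; apply: (@pt_scale c^-1).
  by rewrite invr_eq0.
by rewrite -[vec t](scalerK nzc) -sM -scalemxAl mulmxK.
Qed.

(** The line through two points of [S] has only 6 points, so a further point of [S] lies off it. *)
Lemma triangle (S : {set M3}) : S \subset points -> (6 < #|S|)%N ->
  exists s t r, [/\ rows s t r \in unitmx, pt s \in S, pt t \in S & pt r \in S].
Proof.
move=> SP S6.
have /card_gt1P[p [q [pS qS pq]]] : (1 < #|S|)%N by apply: leq_trans S6.
have [s sr ps] := points_reps (subsetP SP p pS).
have [t tr qt] := points_reps (subsetP SP q qS).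
have st : s != t by apply: contraNneq pq => st; rewrite ps qt st.
have [x xr xU] := line_through sr tr st.
have : ~~ (S \subset [set p in S | (p <= ln x)%MS]).
  apply: contraL S6 => /subset_leq_card; rewrite -leqNgt => /leq_trans; apply.
  exact: card_line.
case/subsetPn=> z zS; rewrite in_set zS.
have [r rr zr] := points_reps (subsetP SP z zS).
rewrite andTb zr pt_ln => /xU uM.
by exists s, t, r; rewrite -ps -qt -zr; split.
Qed.

Definition diag_rows (r : triple) : M3 :=
  rows (r.1.1, 0, 0)%N (0, r.1.2, 0)%N (0, 0, r.2)%N.

Lemma off_triangle_ok : all (fun r => [&& ~~ (5 %| r.1.1), ~~ (5 %| r.1.2),
  ~~ (5 %| r.2) & nonsingular ((r.1.1, 0, 0), (0, r.1.2, 0), (0, 0, r.2))])%N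
  off_triangle.
Proof. by lazy. Qed.

(** Two collineations lead to the standard frame: a triangle in [S] goes to the coordinate triangle,
    then a fourth point goes to [e123]. *)
Lemma classification (S : {set M3}) :
  S \subset points -> #|S| = 10%N -> tangent_free S ->
  exists2 T, proj_equiv S T & trivial_set T \/ conic_interior_set T.
Proof.
move=> SP S10 tS.
have [|s [t [r [uM sS tS' rS]]]] := triangle SP; first by rewrite S10.
set M := rows s t r in uM; have uMV : invmx M \in unitmx by rewrite unitmx_inv.
have nz1 : 1 != 0 :> F by rewrite oner_eq0.
pose S1 := proj_image (invmx M) S.
have S1P : S1 \subset points by apply: proj_image_points.
have S110 : #|S1| = 10%N by rewrite card_proj_image.
have tS1 : tangent_free S1 by apply: tangent_free_proj.
have eM i x : vec i *m M = vec x -> pt x \in S -> pt i \in S1.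
  by move=> iM; apply: (pt_proj uM nz1); rewrite scale1r.
have S1e1 : pt e1 \in S1.
  by apply: eM sS; rewrite vec_mul_rows !scale0r scale1r !addr0.
have S1e2 : pt e2 \in S1.
  by apply: eM tS'; rewrite vec_mul_rows !scale0r scale1r addr0 add0r.
have S1e3 : pt e3 \in S1.
  by apply: eM rS; rewrite vec_mul_rows !scale0r scale1r !add0r.
have [x xo S1x] := triangle_off S1P S110 tS1 S1e1 S1e2 S1e3.
have /and4P[x0 x1 x2 nx] := allP off_triangle_ok x xo.
rewrite -!natF5_eq0 in x0 x1 x2.
(* A diagonal matrix fixes the three vertices and sends [e123] to [x], so its inverse completes the
   frame. *)
have uD : diag_rows x \in unitmx by apply: rows_unit => u /(allP nx).
have uDV : invmx (diag_rows x) \in unitmx by rewrite unitmx_inv.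
pose S2 := proj_image (invmx (diag_rows x)) S1.
exists S2.
  apply: (@proj_equiv_trans _ S1); first by exists (invmx M).
  by exists (invmx (diag_rows x)).
apply: frame_classification.
- exact: proj_image_points.
- by rewrite card_proj_image.
- exact: tangent_free_proj.
move=> i; rewrite !inE => /or4P[]/eqP ->.
- apply: (pt_proj uD x0) S1e1; rewrite vec_mul_rows.
  by apply: rowP3; rewrite !mxE /= ?inordK //=; ring.
- apply: (pt_proj uD x1) S1e2; rewrite vec_mul_rows.
  by apply: rowP3; rewrite !mxE /= ?inordK //=; ring.
- apply: (pt_proj uD x2) S1e3; rewrite vec_mul_rows.
  by apply: rowP3; rewrite !mxE /= ?inordK //=; ring.
apply: (pt_proj uD nz1) S1x; rewrite vec_mul_rows.
by apply: rowP3; rewrite !mxE /= ?inordK //=; ring.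
Qed.

(** * The two standard sets and their inequivalence *)

Lemma proj_equiv_invariants (S T : {set M3}) :
  S \subset points -> #|S| = 10%N -> tangent_free S -> proj_equiv S T ->
  T \subset points /\ #|T| = 10%N /\ tangent_free T.
Proof.
move=> SP S10 tS [g [ug ->]]; rewrite card_proj_image //.
by split; [apply: proj_image_points | split; [|apply: tangent_free_proj]].
Qed.

Lemma trivial_setE T : trivial_set T -> proj_equiv (triv e1 e2) T.
Proof. by case/trivial_setP=> u [w [ur wr uw ->]]; apply: triv_std. Qed.

Lemma card_triv_std : #|triv e1 e2| = 10%N.
Proof. by rewrite card_bits ?triv_sub // bits_triv. Qed.

Lemma tangent_free_triv_std : tangent_free (triv e1 e2).
Proof. by apply/(tangent_free_bitsP (triv_sub _ _)); rewrite bits_triv. Qed.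

Definition unit_form : qform := sym_form 1 1 1 0 0 0.

Lemma unit_formE : form_mx unit_form = 1%:M.
Proof.
by apply/matrixP=> -[[|[|[|//]]] i] [[|[|[|//]]] j]; rewrite !mxE.
Qed.

Lemma bits_interior_std : bits (interior 1%:M) = interior_bits unit_form.
Proof. by rewrite -unit_formE bits_interior. Qed.

Lemma card_interior_std : #|interior 1%:M| = 10%N.
Proof. by rewrite card_bits ?interior_sub // bits_interior_std. Qed.

Lemma tangent_free_interior_std : tangent_free (interior 1%:M).
Proof.
by apply/(tangent_free_bitsP (interior_sub _)); rewrite bits_interior_std.
Qed.

Lemma interior_std_secants :
  all (fun m => count id (mask m (interior_bits unit_form)) <= 3)%N all_lines.
Proof. by lazy. Qed.

Lemma card_line_interior_std (L : M3) : is_line L ->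
  (#|[set p in interior 1%:M | (p <= L)%MS]| <= 3)%N.
Proof.
move=> /is_line_reps[u ur Lu].
rewrite (card_line_bits Lu) ?interior_sub // bits_interior_std.
by apply: (allP interior_std_secants); rewrite map_f.
Qed.

Lemma card_line_triv_std : #|[set p in triv e1 e2 | (p <= ln e1)%MS]| = 5%N.
Proof.
rewrite (@card_line_bits _ _ e1) ?triv_sub // bits_triv.
by lazy.
Qed.

(** A collineation preserves secant sizes: the image [ln e1 *m g] of a 5-secant would meet the conic
    interior in 5 points, against the bound 3. *)
Lemma triv_not_interior_std : ~ proj_equiv (triv e1 e2) (interior 1%:M).
Proof.
case=> g [ug E]; have lL : is_line (ln e1 *m g).
  by rewrite is_lineM // is_line_ln.
have := card_line_interior_std lL.
by rewrite E card_line_proj ?triv_sub // mulmxK // card_line_triv_std.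
Qed.

Theorem mainTheorem8 :
  (* both families consist of tangent-free sets of size 10, and both exist *)
  (forall T, trivial_set T -> T \subset points /\ #|T| = 10%N /\ tangent_free T) /\
  (forall T, conic_interior_set T -> T \subset points /\ #|T| = 10%N /\ tangent_free T) /\
  (exists T, trivial_set T) /\ (exists T, conic_interior_set T) /\
  (* each family forms a single projective class *)
  (forall T1 T2, trivial_set T1 -> trivial_set T2 -> proj_equiv T1 T2) /\
  (forall T1 T2, conic_interior_set T1 -> conic_interior_set T2 -> proj_equiv T1 T2) /\
  (* classification *)
  (forall S : {set M3}, S \subset points -> #|S| = 10%N -> tangent_free S ->
     (exists T, trivial_set T /\ proj_equiv S T) \/
     (exists T, conic_interior_set T /\ proj_equiv S T)) /\
  (* the two classes are distinct *)
  (forall T1 T2, trivial_set T1 -> conic_interior_set T2 -> ~ proj_equiv T1 T2).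
Proof.
have tP := triv_sub e1 e2; have iP := interior_sub 1%:M.
split; first by move=> T /trivial_setE; apply: proj_equiv_invariants;
  [|exact: card_triv_std|exact: tangent_free_triv_std].
split; first by move=> T /conic_interior_std; apply: proj_equiv_invariants;
  [|exact: card_interior_std|exact: tangent_free_interior_std].
split; first by exists (triv e1 e2); apply: trivial_set_triv.
split.
  by exists (interior (form_mx unit_form)); apply: conic_interior_form.
split.
  move=> T1 T2 /trivial_setE E1 /trivial_setE.
  exact: proj_equiv_trans (proj_equiv_sym tP E1).
split.
  move=> T1 T2 /conic_interior_std E1 /conic_interior_std.
  exact: proj_equiv_trans (proj_equiv_sym iP E1).
split.
  move=> S SP S10 tS; have [T ST [tT|cT]] := classification SP S10 tS.
    by left; exists T.
  by right; exists T.
(* Composed with the equivalences to the standard sets, [E12] would identify the standard sets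
   themselves. *)
move=> T1 T2 /trivial_setE E1 /conic_interior_std E2 E12.
apply: triv_not_interior_std; apply: proj_equiv_trans E1 _.
exact: proj_equiv_trans E12 (proj_equiv_sym iP E2).
Qed.
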